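(* There exists a magic hourglass of squares $$\begin{bmatrix} a^2&b^2&c^2\\ -&e^2&-\\ g^2&h^2&i^2\end{bmatrix}$$ if and only if there exist integers $A,B,C$, elements $\alpha,\beta,\gamma$ of the ring $K=\mathbb{Z}[\sqrt{-1},\sqrt{A},\sqrt{B},\sqrt{C}]\subset\mathbb{C}$, and integers $a,b,c,e,g,h,i$ such that $$\alpha^4+\beta^4+\gamma^4\in\mathbb{Z},\qquad \alpha^2,\beta^2,\gamma^2\in\mathbb{Z}[\sqrt{-1}],\qquad \alpha\overline{\alpha}=\beta\overline{\beta}=\gamma\overline{\gamma},$$ $$(a,e,i)=\chi(\alpha),\qquad (b,e,h)=\chi(\beta),\qquad (c,e,g)=\chi(\gamma),$$ and $\alpha^4,\beta^4,\gamma^4$ are pairwise distinct and strictly complex (i.e. none of them is real).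
   Context: A magic hourglass of squares consists of seven distinct squared integers $a^2,b^2,c^2,e^2,g^2,h^2,i^2$ (with $a,b,c,e,g,h,i\in\mathbb{Z}$), placed as displayed in the claim, such that for some integer $T$, $$a^2+e^2+i^2=b^2+e^2+h^2=c^2+e^2+g^2=T\quad\text{and}\quad a^2+b^2+c^2=g^2+h^2+i^2=T.$$ For a complex number $\omega$, define $$\chi(\omega)=\bigl(\mathrm{Re}[\omega^2]+\mathrm{Im}[\omega^2],\ \omega\overline{\omega},\ \mathrm{Re}[\omega^2]-\mathrm{Im}[\omega^2]\bigr).$$ The letter $i$ denotes an integer entry of the hourglass; the imaginary unit is written $\sqrt{-1}$. The bar denotes complex conjugation. *)

(* Defs.v *)
From mathcomp Require Import all_boot all_order all_algebra.
From mathcomp Require Import boolp classical_sets reals.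
From mathcomp.real_closed Require Import complex.
Set Implicit Arguments.
Unset Strict Implicit.
Unset Printing Implicit Defensive.
Import Order.TTheory GRing.Theory Num.Theory.
Local Open Scope ring_scope.
Local Open Scope classical_set_scope.

Definition magic_hourglass (a b c e g h i : int) : Prop :=
  uniq [:: a ^+ 2; b ^+ 2; c ^+ 2; e ^+ 2; g ^+ 2; h ^+ 2; i ^+ 2] /\
  exists T : int,
    [/\ a ^+ 2 + e ^+ 2 + i ^+ 2 = T,
        b ^+ 2 + e ^+ 2 + h ^+ 2 = T,
        c ^+ 2 + e ^+ 2 + g ^+ 2 = T,
        a ^+ 2 + b ^+ 2 + c ^+ 2 = T &
        g ^+ 2 + h ^+ 2 + i ^+ 2 = T].

(* 'Re and 'Im take their (real) values in the complex field itself, so the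
   three components of chi live in R[i]. *)
Definition chi (R : realType) (w : R[i]) : R[i] * R[i] * R[i] :=
  ('Re (w ^+ 2) + 'Im (w ^+ 2), w * w^*, 'Re (w ^+ 2) - 'Im (w ^+ 2)).

(* Z[G]: every subring contains Z, so this is the least subring containing G. *)
Definition adjoinZ (R : realType) (G : set R[i]) : set R[i] :=
  smallest (fun S : set R[i] => GRing.subring_closed (mem S)) G.

Definition gaussZ (R : realType) : set R[i] := adjoinZ [set 'i].

(* sqrtC is the principal root; as -1 lies in every subring, the choice of the
   root does not affect the ring. *)
Definition ringK (R : realType) (A B C : int) : set R[i] :=
  adjoinZ [set z | z \in [:: 'i; sqrtC A%:~R; sqrtC B%:~R; sqrtC C%:~R]].

(* Main.v *)
Require Import Defs.
From mathcomp Require Import all_boot all_order all_algebra.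
From mathcomp Require Import boolp classical_sets reals.
From mathcomp.real_closed Require Import complex.
From mathcomp Require Import zify ring lra.
Set Implicit Arguments.
Unset Strict Implicit.
Import Order.TTheory GRing.Theory Num.Theory.
Local Open Scope ring_scope.

(** An hourglass has T = 3 e ^ 2, so it amounts to three pairs of squares with
    a ^ 2 + i ^ 2 = b ^ 2 + h ^ 2 = c ^ 2 + g ^ 2 = 2 e ^ 2, subject to
    a ^ 2 + b ^ 2 + c ^ 2 = 3 e ^ 2 and to distinctness. A pair with
    a ^ 2 + i ^ 2 = 2 e ^ 2 is the same as x ^ 2 + y ^ 2 = e ^ 2 for a = x + y and
    i = x - y, and (a, e, i) = chi (alpha) says that x + 'i y is alpha ^ 2 and
    that e is its modulus. The imaginary part of alpha ^ 4 is then
    (a ^ 2 - i ^ 2) / 2 = a ^ 2 - e ^ 2: hence the remaining linear condition is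
    that the sum of the fourth powers is an integer ([chi_quartic_sum]), and
    alpha ^ 4 is real exactly when a ^ 2 = i ^ 2 ([chi_quartic_real]).

    From an hourglass to alpha, beta, gamma, the point is to find a square root
    of x + 'i y in Z['i, sqrt d] for a single integer d. After a change of sign
    of a, which the hourglass does not see, y is even, and the
    parametrisation of Pythagorean triples gives
    x + 'i y = d (r + s 'i) ^ 2 with d >= 0, hence alpha = sqrt d (r + s 'i)
    ([chi_preimage]).

    Conversely distinctness of the seven squares is the only issue, because the
    hypotheses allow alpha ^ 4 and beta ^ 4 to be distinct with the same
    imaginary part, and then a ^ 2 = b ^ 2. In that case, with
    d = a ^ 2 - e ^ 2 nonzero, the five numbers e ^ 2 + j d for j from -2 to 2
    are squares. This is impossible: it would make X ^ 2 - Y ^ 2 and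
    X ^ 2 - 4 Y ^ 2 squares for X = e ^ 2 and Y = d, which is excluded by infinite
    descent ([two_squares_descent], [five_squares_progression]). *)

(** * Squares and Pythagorean triples over the natural numbers *)

(** Bilinearity of the gcd gives
    gcd (p, y) ^ 2 = gcd (p ^ 2, p y, y ^ 2) = p gcd (p, y, q). *)
Lemma mul_eq_sqr_coprime (p q y : nat) :
  (p * q = y ^ 2)%N -> coprime p q -> p = (gcdn p y ^ 2)%N.
Proof.
move=> pq /eqP co; transitivity (p * gcdn (gcdn p q) y)%N.
  by rewrite co gcd1n muln1.
rewrite -mulnn muln_gcdl !muln_gcdr pq [(y * p)%N]mulnC.
by rewrite !mulnn -!gcdnA [in RHS](gcdnA (p * y)%N) gcdnn (gcdnC (y ^ 2)%N).
Qed.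

(** Dividing p and q by their gcd d leaves coprime factors whose product is still
    a square, so that each of them is a square. *)
Lemma mul_eq_sqr (p q y : nat) : (p * q = y ^ 2)%N ->
  exists d r s : nat,
    [/\ p = (d * r ^ 2)%N, q = (d * s ^ 2)%N, y = (d * (r * s))%N & coprime r s].
Proof.
move=> pq; have [d0|d_gt0] := posnP (gcdn p q).
  have [p0 q0] : p = 0%N /\ q = 0%N.
    by move/eqP: d0; rewrite -[_ == _]negbK -lt0n gcdn_gt0; lia.
  by exists 0%N, 1%N, 1%N; split; rewrite ?coprime1n //; nia.
set d := gcdn p q in d_gt0 *.
have /dvdnP [p' pE] : (d %| p)%N by apply: dvdn_gcdl.
have /dvdnP [q' qE] : (d %| q)%N by apply: dvdn_gcdr.
have co : coprime p' q'.
  rewrite /coprime -(eqn_pmul2r d_gt0) mul1n muln_gcdl -pE -qE.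
  exact: eqxx.
have /dvdnP [y' yE] : (d %| y)%N.
  rewrite -(@dvdn_pexp2r d y 2) // -pq pE qE.
  by apply/dvdnP; exists (p' * q')%N; lia.
have pq' : (p' * q' = y' ^ 2)%N.
  by apply/eqP; rewrite -(@eqn_pmul2r (d ^ 2)) ?expn_gt0 ?d_gt0 //; apply/eqP; nia.
have p2 := mul_eq_sqr_coprime pq' co.
have q2 : q' = (gcdn q' y' ^ 2)%N.
  by apply: (@mul_eq_sqr_coprime _ p'); rewrite 1?mulnC 1?coprime_sym.
exists d, (gcdn p' y'), (gcdn q' y'); split.
- by rewrite -p2 mulnC.
- by rewrite -q2 mulnC.
- rewrite yE mulnC; congr (_ * _)%N.
  by apply/eqP; rewrite -(@eqn_exp2r _ _ 2) // expnMn -p2 -q2 pq'.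
apply: coprime_dvdl (dvdn_gcdl _ _) _.
by apply: coprime_dvdr (dvdn_gcdl _ _) _.
Qed.

(** As x and w have the same parity, the factorisation
    y ^ 2 = ((x - w) / 2) ((x + w) / 2) is integral. The common factor d is
    kept, since a non-square d is what forces the extension by sqrt d. *)
Lemma pythagorean_even_leg (x y w : nat) : (x ^ 2 = (2 * y) ^ 2 + w ^ 2)%N ->
  exists d r s : nat,
    [/\ x = (d * (r ^ 2 + s ^ 2))%N, (d * s ^ 2 = w + d * r ^ 2)%N,
        y = (d * (r * s))%N & coprime r s].
Proof.
move=> E.
have le_wx : (w <= x)%N by nia.
have [p xE] : exists p, x = (w + 2 * p)%N.
  have ox : odd (x ^ 2) = odd (w ^ 2) by rewrite E expnMn; lia.
  by exists ((x - w)./2); move: ox; rewrite !oddX /=; lia.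
have /mul_eq_sqr [d [r [s [pE qE yE co]]]] : (p * (p + w) = y ^ 2)%N.
  by move: E; rewrite xE; lia.
by exists d, r, s; split=> //; lia.
Qed.

Lemma pythagorean_coprime (x y w : nat) : (x ^ 2 = (2 * y) ^ 2 + w ^ 2)%N ->
  coprime x y -> exists r s : nat,
    [/\ x = (r ^ 2 + s ^ 2)%N, (s ^ 2 = w + r ^ 2)%N, y = (r * s)%N & coprime r s].
Proof.
move=> /pythagorean_even_leg [d [r [s [xE wE yE co]]]] /eqP coxy.
have d1 : d = 1%N.
  apply/eqP; rewrite -dvdn1 -coxy dvdn_gcd xE yE.
  by rewrite !dvdn_mulr.
by exists r, s; move: xE wE yE; rewrite d1 !mul1n.
Qed.

(** * Fermat descent: x ^ 2 - y ^ 2 and x ^ 2 - 4 y ^ 2 both squares *)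

Lemma sqr_odd (n : nat) : odd n -> exists k, (n ^ 2 = 8 * k + 1)%N.
Proof.
move=> on; have [k ->] : exists k, n = (2 * k + 1)%N by exists n./2; lia.
have [l] : exists l, (k * (k + 1) = 2 * l)%N.
  by exists (k * (k + 1))./2; have : ~~ odd (k * (k + 1)); rewrite ?oddM ?oddD; lia.
by exists l; lia.
Qed.

(** One step of the descent. The four-number factorisation r = a g, s = b c,
    R = b g, S = a c of R S = r s turns the equality of the sums of squares
    into g ^ 2 (a ^ 2 - 4 b ^ 2) = c ^ 2 (a ^ 2 - b ^ 2), so that, g and c being
    coprime, a ^ 2 - 4 b ^ 2 = k c ^ 2 and a ^ 2 - b ^ 2 = k g ^ 2 for one
    integer k. Since a and b are coprime k divides 3, and since a and c are odd
    k = 1 modulo 4. If k = 1 then (a, b) solves the system. If k = -3, solving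
    the two equations for a ^ 2 and b ^ 2 gives b ^ 2 = c ^ 2 - g ^ 2 and
    a ^ 2 = c ^ 2 - 4 g ^ 2, so (c, g) solves it instead. *)
Lemma descent_step (r s R S : nat) : (0 < r * s)%N -> coprime r s -> odd S ->
  coprime R S -> (R * S = r * s)%N -> (r ^ 2 + s ^ 2 = (2 * R) ^ 2 + S ^ 2)%N ->
  exists x y w z : nat, [/\ (0 < y)%N, (x <= S)%N,
    (x ^ 2 = y ^ 2 + w ^ 2)%N & (x ^ 2 = (2 * y) ^ 2 + z ^ 2)%N].
Proof.
move=> rs0 co oS coRS RS E.
have [r0 s0] : (0 < r /\ 0 < s)%N by move: rs0; rewrite muln_gt0 => /andP.
have g0 : (0 < gcdn R r)%N by rewrite gcdn_gt0 r0 orbT.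
have /dvdnP [b RE] := dvdn_gcdl R r; have /dvdnP [a rE] := dvdn_gcdr R r.
have coba : coprime b a.
  by rewrite /coprime -(eqn_pmul2r g0) mul1n muln_gcdl -RE -rE.
set g := gcdn R r in g0 RE rE.
have a0 : (0 < a)%N by move: r0; rewrite rE muln_gt0 => /andP [].
have bS : (b * S = a * s)%N.
  by apply/eqP; rewrite -(eqn_pmul2r g0); apply/eqP; move: RS; rewrite RE rE; lia.
have /dvdnP [c SE] : (a %| S)%N.
  by rewrite -(@Gauss_dvdr _ b) 1?coprime_sym // bS dvdn_mulr.
have sE : s = (b * c)%N.
  by apply/eqP; rewrite -(eqn_pmul2l a0) -bS SE; apply/eqP; lia.
have b0 : (0 < b)%N by move: s0; rewrite sE muln_gt0 => /andP [].
have c0 : (0 < c)%N by move: s0; rewrite sE muln_gt0 => /andP [].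
have cogc : coprime g c.
  apply: (@coprime_dvdl _ r); first by rewrite rE dvdn_mull.
  by apply: (@coprime_dvdr _ s); first by rewrite sE dvdn_mull.
have [oa oc] : odd a /\ odd c by move: oS; rewrite SE oddM => /andP [].
have {E} E : (g%:Z ^+ 2 * (a%:Z ^+ 2 - 4 * b%:Z ^+ 2) =
    c%:Z ^+ 2 * (a%:Z ^+ 2 - b%:Z ^+ 2)).
  by move: E; rewrite rE sE RE SE; lia.
have /dvdzP [k kE] : (c%:Z ^+ 2 %| a%:Z ^+ 2 - 4 * b%:Z ^+ 2)%Z.
  rewrite -(@Gauss_dvdzr _ (g%:Z ^+ 2)); first by rewrite E dvdz_mulr.
  by rewrite coprimezE !abszX /= coprimeXl // coprimeXr // coprime_sym.
have kE' : a%:Z ^+ 2 - b%:Z ^+ 2 = k * g%:Z ^+ 2.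
  have c20 : c%:Z ^+ 2 != 0 by rewrite expf_neq0 //; lia.
  by apply: (mulfI c20); rewrite -E kE; ring.
have k3 : (k %| 3)%Z.
  have : coprimez (a%:Z ^+ 2) (b%:Z ^+ 2).
    by rewrite coprimezE !abszX /= coprimeXl // coprimeXr // coprime_sym.
  case/coprimezP => [[u v]] /= uv.
  apply/dvdzP; exists (u * (4 * g%:Z ^+ 2 - c%:Z ^+ 2) + v * (g%:Z ^+ 2 - c%:Z ^+ 2)).
  rewrite (_ : _ * k = u * (4 * (k * g%:Z ^+ 2) - k * c%:Z ^+ 2)
    + v * (k * g%:Z ^+ 2 - k * c%:Z ^+ 2)); last by ring.
  rewrite -kE -kE'.
  by transitivity (3 * (u * a%:Z ^+ 2 + v * b%:Z ^+ 2)); [rewrite uv|ring].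
have kmod : exists t, k = 4 * t + 1.
  have [A AE] := sqr_odd oa; have [C CE] := sqr_odd oc.
  have {}AE : a%:Z ^+ 2 = 8 * A%:Z + 1 by lia.
  have {}CE : c%:Z ^+ 2 = 8 * C%:Z + 1 by lia.
  exists (2 * A%:Z - b%:Z ^+ 2 - 2 * k * C%:Z).
  by move: kE; rewrite AE CE; lia.
have [kk|kk] : k = 1 \/ k = -3.
  case: kmod => t tE; have : (`|k| %| 3)%N by exact: k3.
  move=> /[dup] /dvdn_leq; move=> /(_ isT) le3.
  have : `|k|%N = 0%N \/ `|k|%N = 1%N \/ `|k|%N = 2%N \/ `|k|%N = 3%N by lia.
  by case=> [|[|[|]]] E3; rewrite E3 //; lia.
- exists a, b, g, c; split=> //; first by rewrite SE leq_pmull.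
    by move: kE'; rewrite kk; lia.
  by move: kE; rewrite kk; lia.
exists c, g, b, a; split=> //; first by rewrite SE leq_pmulr.
  by move: kE kE'; rewrite kk; lia.
by move: kE kE'; rewrite kk; lia.
Qed.

(** Fermat's descent on x. In a coprime solution x is odd and y is even, so both
    equations are primitive Pythagorean triples and x is a sum of two squares
    r ^ 2 + s ^ 2 = R ^ 2 + S ^ 2 with R S = 2 r s; then [descent_step] produces
    a nontrivial solution whose x is at most S, hence smaller. *)
Lemma two_squares_descent (x y w z : nat) :
  (x ^ 2 = y ^ 2 + w ^ 2)%N -> (x ^ 2 = (2 * y) ^ 2 + z ^ 2)%N -> y = 0%N.
Proof.
have [n] := ubnP x; elim: n x y w z => // n IHn x y w z ltxn E1 E2.
have [// | y_gt0] := posnP y.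
(* A common factor divides w and z too, and dividing it out is a descent. *)
have [g_gt1|] := ltnP 1 (gcdn x y).
  have /dvdnP [x' xE] := dvdn_gcdl x y.
  have /dvdnP [y' yE] := dvdn_gcdr x y.
  set g := gcdn x y in g_gt1 xE yE.
  have /dvdnP [w' wE] : (g %| w)%N.
    rewrite -(@dvdn_pexp2r g w 2) //.
    have -> : (w ^ 2 = x ^ 2 - y ^ 2)%N by lia.
    by rewrite xE yE !expnMn -mulnBl dvdn_mull.
  have /dvdnP [z' zE] : (g %| z)%N.
    rewrite -(@dvdn_pexp2r g z 2) //.
    have -> : (z ^ 2 = x ^ 2 - (2 * y) ^ 2)%N by lia.
    by rewrite xE yE mulnA !expnMn -mulnBl dvdn_mull.
  have g2 : (0 < g ^ 2)%N by rewrite expn_gt0; lia.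
  suff y'0 : y' = 0%N by move: y_gt0; rewrite yE y'0.
  apply: (IHn x' y' w' z').
  - by nia.
  - by apply/eqP; rewrite -(eqn_pmul2r g2); apply/eqP; nia.
  - by apply/eqP; rewrite -(eqn_pmul2r g2); apply/eqP; nia.
have g_gt0 : (0 < gcdn x y)%N by rewrite gcdn_gt0 y_gt0 orbT.
move=> g_le1; have co : gcdn x y = 1%N by lia.
have ox : odd x.
  apply/negPn/negP => /negbTE ex.
  have oy : odd y.
    apply/negPn/negP => ey; suff : (2 %| gcdn x y)%N by rewrite co.
    by rewrite dvdn_gcd !dvdn2 ex ey.
  have ow : odd w.
    have : odd (x ^ 2) = odd (y ^ 2 + w ^ 2) by rewrite E1.
    by rewrite oddD !oddX /= oy; case: odd ex => //; lia.
  have [k kE] : exists k, x = (2 * k)%N by exists x./2; lia.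
  have [l lE] := sqr_odd oy; have [m mE] := sqr_odd ow.
  by move: E1; rewrite kE lE mE; lia.
have ey : ~~ odd y.
  apply/negP => oy.
  have oz : odd z.
    have : odd (x ^ 2) = odd ((2 * y) ^ 2 + z ^ 2) by rewrite E2.
    by rewrite oddD expnMn oddM !oddX /= ox.
  have [k kE] := sqr_odd ox; have [l lE] := sqr_odd oy.
  by have [m mE] := sqr_odd oz; move: E2; rewrite expnMn kE lE mE; lia.
have [v yE] : exists v, y = (2 * v)%N by exists y./2; lia.
have coxv : coprime x v.
  by apply: (@coprime_dvdr _ y); [rewrite yE dvdn_mull | rewrite /coprime co].
have E1' : (x ^ 2 = (2 * v) ^ 2 + w ^ 2)%N by rewrite -yE.
have [r [s [xE _ vE cors]]] := pythagorean_coprime E1' coxv.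
have [R [S [xE' _ yE' coRS]]] := pythagorean_coprime E2 (introT eqP co).
have v0 : (0 < v)%N by lia.
(* R and S play symmetric roles, and x odd makes exactly one of them even. *)
wlog oS : R S xE' yE' coRS / odd S.
  move=> W; have [|eS] := boolP (odd S); first exact: (W R S).
  apply: (W S R).
  - by rewrite addnC.
  - by rewrite mulnC.
  - by rewrite coprime_sym.
  - by move: ox; rewrite xE' oddD !oddX /= (negbTE eS) addbF.
have eR : ~~ odd R.
  by apply/negP => oR; have := ox; rewrite xE' oddD !oddX /= oS oR.
have [T RE] : exists T, R = (2 * T)%N by exists R./2; lia.
have TS : (T * S = r * s)%N by move: yE'; rewrite yE vE RE; lia.
have coTS : coprime T S by apply: coprime_dvdl coRS; rewrite RE dvdn_mull.
have rs0 : (0 < r * s)%N by rewrite -vE.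
have sum : (r ^ 2 + s ^ 2 = (2 * T) ^ 2 + S ^ 2)%N by rewrite -RE -xE -xE'.
have [x' [y' [w' [z' [y'0 lex F1 F2]]]]] := descent_step rs0 cors oS coTS TS sum.
suff y'E : y' = 0%N by rewrite y'E in y'0.
apply: (IHn x' y' w' z') => //.
have T0 : (0 < T)%N by move: rs0; rewrite -TS muln_gt0 => /andP [].
rewrite ltnS in ltxn; apply: leq_trans ltxn; rewrite xE' RE.
apply: leq_ltn_trans lex _; rewrite -[ltnLHS]add0n -addSn.
apply: leq_add; first by rewrite expn_gt0 muln_gt0 T0.
by rewrite -mulnn leq_pmulr // odd_gt0.
Qed.

(** * Five squares in arithmetic progression and the hourglass *)

Lemma absz_sum_sqr (x y z : int) :
  x ^+ 2 = y ^+ 2 + z ^+ 2 -> (`|x| ^ 2 = `|y| ^ 2 + `|z| ^ 2)%N.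
Proof.
rewrite -!abszX; move: (sqr_ge0 y) (sqr_ge0 z).
by move: (x ^+ 2) (y ^+ 2) (z ^+ 2) => *; lia.
Qed.

Lemma two_squares_degenerate (x y w z : int) :
  x ^+ 2 = y ^+ 2 + w ^+ 2 -> x ^+ 2 = (2 * y) ^+ 2 + z ^+ 2 -> y = 0.
Proof.
move=> E1 E2; apply/eqP; rewrite -absz_eq0; apply/eqP.
by apply: (@two_squares_descent `|x| _ `|w| `|z|);
  rewrite ?(absz_sum_sqr E1) // -(absz_sum_sqr E1) (absz_sum_sqr E2) abszM.
Qed.

(** The products q s and p t satisfy e ^ 4 - d ^ 2 = (q s) ^ 2 and
    e ^ 4 - (2 d) ^ 2 = (p t) ^ 2, which is the system ruled out by descent. *)
Lemma five_squares_progression (e d p q s t : int) :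
  p ^+ 2 = e ^+ 2 - 2 * d -> q ^+ 2 = e ^+ 2 - d ->
  s ^+ 2 = e ^+ 2 + d -> t ^+ 2 = e ^+ 2 + 2 * d -> d = 0.
Proof.
move=> pE qE sE tE.
have E1 : (e ^+ 2) ^+ 2 = d ^+ 2 + (q * s) ^+ 2.
  by rewrite [(q * s) ^+ 2]exprMn qE sE; ring.
have E2 : (e ^+ 2) ^+ 2 = (2 * d) ^+ 2 + (p * t) ^+ 2.
  by rewrite [(p * t) ^+ 2]exprMn pE tE; ring.
exact: two_squares_degenerate E1 E2.
Qed.

(** With d = a ^ 2 - e ^ 2, the hypotheses make c ^ 2, i ^ 2, e ^ 2, a ^ 2, g ^ 2
    an arithmetic progression of difference d. They are those of an
    hourglass except that the entries a and b have the same square. *)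
Lemma equal_squares_degenerate (a c e g i : int) :
  a ^+ 2 + i ^+ 2 = 2 * e ^+ 2 -> c ^+ 2 + g ^+ 2 = 2 * e ^+ 2 ->
  2 * a ^+ 2 + c ^+ 2 = 3 * e ^+ 2 -> a ^+ 2 = i ^+ 2.
Proof.
move=> E1 E2 E3.
have : a ^+ 2 - e ^+ 2 = 0.
  apply: (@five_squares_progression e _ c i a g); lra.
by lra.
Qed.

(** Write a ^ 2 = e ^ 2 + d1 and i ^ 2 = e ^ 2 - d1, and likewise d2 for b, h and
    d3 for c, g. Then d1 + d2 + d3 = 0 with every dj nonzero. A coincidence
    dj = - dk makes the third one zero, and dj = dk is excluded by
    [equal_squares_degenerate]. *)
Lemma magic_hourglass_of_diagonals (a b c e g h i : int) :
  a ^+ 2 + i ^+ 2 = 2 * e ^+ 2 -> b ^+ 2 + h ^+ 2 = 2 * e ^+ 2 ->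
  c ^+ 2 + g ^+ 2 = 2 * e ^+ 2 -> a ^+ 2 + b ^+ 2 + c ^+ 2 = 3 * e ^+ 2 ->
  a ^+ 2 != i ^+ 2 -> b ^+ 2 != h ^+ 2 -> c ^+ 2 != g ^+ 2 ->
  magic_hourglass a b c e g h i.
Proof.
move=> Ea Eb Ec Et /eqP na /eqP nb /eqP nc.
have nab : a ^+ 2 <> b ^+ 2.
  by move=> ab; apply: na; apply: (equal_squares_degenerate Ea Ec); lra.
have nac : a ^+ 2 <> c ^+ 2.
  by move=> ac; apply: na; apply: (equal_squares_degenerate Ea Eb); lra.
have nbc : b ^+ 2 <> c ^+ 2.
  by move=> bc; apply: nb; apply: (equal_squares_degenerate Eb Ea); lra.
split; last by exists (3 * e ^+ 2); split; lra.
move: na nb nc nab nac nbc Ea Eb Ec Et; rewrite /= !inE !negb_or.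
move: (a ^+ 2) (b ^+ 2) (c ^+ 2) (e ^+ 2) (g ^+ 2) (h ^+ 2) (i ^+ 2).
move=> a2 b2 c2 e2 g2 h2 i2 *.
by repeat (apply/andP; split) => //; apply/eqP; lia.
Qed.

(** The six outer squares sum to 2 T by rows, and to 3 (T - e ^ 2) along the three
    lines through the centre, so T = 3 e ^ 2. *)
Lemma diagonals_of_magic_hourglass (a b c e g h i : int) :
  magic_hourglass a b c e g h i ->
  [/\ a ^+ 2 + i ^+ 2 = 2 * e ^+ 2, b ^+ 2 + h ^+ 2 = 2 * e ^+ 2,
      c ^+ 2 + g ^+ 2 = 2 * e ^+ 2 & a ^+ 2 + b ^+ 2 + c ^+ 2 = 3 * e ^+ 2].
Proof. by move=> [_ [T [? ? ? ? ?]]]; split; lra. Qed.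

(** * Gaussian integers whose norm is a square *)

(** The cases restore the signs that are lost in [pythagorean_even_leg]:
    exchanging r and s changes the sign of x, negating r or s that of y. *)
Lemma two_squares_param (x y e : int) : x ^+ 2 + (2 * y) ^+ 2 = e ^+ 2 ->
  exists d r s : int, [/\ 0 <= d, x = d * (r ^+ 2 - s ^+ 2), y = d * (r * s)
    & `|e| = d * (r ^+ 2 + s ^+ 2)].
Proof.
move=> E; have /pythagorean_even_leg : (`|e| ^ 2 = (2 * `|y|) ^ 2 + `|x| ^ 2)%N.
  by rewrite (@absz_sum_sqr e (2 * y) x) ?abszM // -E addrC.
move=> [d [r [s [eE xE yE _]]]].
have sqrZ (n : nat) : (n ^ 2)%N = n%:Z ^+ 2 :> int by rewrite expr2 -PoszM mulnn.
have {}eE : `|e| = d%:Z * (r%:Z ^+ 2 + s%:Z ^+ 2).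
  by move/(congr1 Posz): eE; rewrite PoszM PoszD !sqrZ abszE.
have {}yE : `|y| = d%:Z * (r%:Z * s%:Z).
  by move/(congr1 Posz): yE; rewrite !PoszM abszE.
have {}xE : d%:Z * s%:Z ^+ 2 = `|x| + d%:Z * r%:Z ^+ 2.
  by move/(congr1 Posz): xE; rewrite PoszD !PoszM abszE.
have d0 : 0 <= d%:Z by lia.
have [x0|x0] := leP 0 x; have [y0|y0] := leP 0 y.
- exists d%:Z, s%:Z, r%:Z.
  rewrite ger0_norm // in xE yE; rewrite ger0_norm // in yE; split=> //; lra.
- exists d%:Z, (- s%:Z), r%:Z.
  rewrite ger0_norm // in xE; rewrite ltr0_norm // in yE; split=> //; lra.
- exists d%:Z, r%:Z, s%:Z.
  rewrite ltr0_norm // in xE; rewrite ger0_norm // in yE; split=> //; lra.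
- exists d%:Z, (- r%:Z), s%:Z.
  rewrite ltr0_norm // in xE; rewrite ltr0_norm // in yE; split=> //; lra.
Qed.

(** Replacing a by - a exchanges (a + i) / 2 and (a - i) / 2 up to sign. The sum
    of their squares is e ^ 2, so at least one of them is even; the sign of
    x + 2 y is chosen to make (x + 2 y - i) / 2 = 2 y even. *)
Lemma sum_and_double_difference (a i e : int) : a ^+ 2 + i ^+ 2 = 2 * e ^+ 2 ->
  exists x y : int, (x + 2 * y) ^+ 2 = a ^+ 2 /\ i = x - 2 * y.
Proof.
move=> E.
have par (m : int) : exists n, m = 2 * n \/ m = 2 * n + 1 by exists (m %/ 2)%Z; lia.
have [u [uE|uE]] := par a; have [v [vE|vE]] := par i.
(* When a and i are even so is e, and a / 2 and i / 2 have the same parity. *)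
- have [f fE] : exists f, e = 2 * f.
    by have [f [?|fE]] := par e; exists f => //; move: E; rewrite uE vE fE; lia.
  have {}E : u ^+ 2 + v ^+ 2 = 2 * f ^+ 2 by move: E; rewrite uE vE fE; lra.
  have [k [kE|kE]] := par (u - v).
    by exists (u + v), k; rewrite uE vE; split; [congr (_ ^+ 2)|]; lra.
  have {}kE : u = v + (2 * k + 1) by lra.
  by move: E; rewrite kE; lia.
- by move: E; rewrite uE vE; lia.
- by move: E; rewrite uE vE; lia.
have [k [kE|kE]] := par (u - v).
  by exists (u + v + 1), k; rewrite uE vE; split; [congr (_ ^+ 2)|]; lra.
have [l lE] : exists l, - u - v - 1 = 2 * l by exists (- v - k - 1); lra.
exists (v - u), l; rewrite uE vE; split; last by lra.
by rewrite -lE; ring.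
Qed.

(** * Subrings generated by a set of complex numbers *)

Lemma adjoinZ_gen (R : realType) (G : set R[i]) z : G z -> adjoinZ G z.
Proof. by move=> Gz S [_]; apply. Qed.

Lemma adjoinZ_subring (R : realType) (G : set R[i]) :
  GRing.subring_closed (mem (adjoinZ G)).
Proof.
split=> [|x y /set_mem Gx /set_mem Gy|x y /set_mem Gx /set_mem Gy];
  apply/mem_set => S /[dup] SG [[S1 SB SM] _]; apply/set_mem => //.
- by apply: SB; apply/mem_set; [apply: Gx|apply: Gy].
- by apply: SM; apply/mem_set; [apply: Gx|apply: Gy].
Qed.

Lemma adjoinZ_mul (R : realType) (G : set R[i]) x y :
  adjoinZ G x -> adjoinZ G y -> adjoinZ G (x * y).
Proof.
have [_ _ GM] := adjoinZ_subring G.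
by move=> Gx Gy; apply/set_mem/GM; apply/mem_set.
Qed.

Lemma adjoinZ_add (R : realType) (G : set R[i]) x y :
  adjoinZ G x -> adjoinZ G y -> adjoinZ G (x + y).
Proof.
have [_ GD] := GRing.zmod_closedD (GRing.subring_closedB (adjoinZ_subring G)).
by move=> Gx Gy; apply/set_mem/GD; apply/mem_set.
Qed.

Lemma adjoinZ_int (R : realType) (G : set R[i]) (n : int) : adjoinZ G n%:~R.
Proof.
have [G1 _ _] := adjoinZ_subring G.
have [G0 GB] := GRing.subring_closedB (adjoinZ_subring G).
have Gn (m : nat) : adjoinZ G m%:R.
  elim: m => [|m IHm]; first exact/set_mem.
  by rewrite -addn1 natrD; apply: adjoinZ_add => //; apply/set_mem.
case: n => m; first exact: Gn.
rewrite NegzE mulrNz -sub0r; apply/set_mem/GB => //; exact: mem_set (Gn m.+1).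
Qed.

(** * The map chi *)

(** With alpha ^ 2 = x + 'i y one has a = x + y, i = x - y and
    e ^ 2 = x ^ 2 + y ^ 2, while alpha ^ 4 = (x ^ 2 - y ^ 2) + 2 'i x y. *)
Lemma chi_spec (R : realType) (al : R[i]) (a e i : int) :
  (a%:~R, e%:~R, i%:~R) = chi al ->
  a ^+ 2 + i ^+ 2 = 2 * e ^+ 2 /\
  al ^+ 4 = (a * i)%:~R + 'i * ((a ^+ 2 - i ^+ 2)%:~R / 2).
Proof.
rewrite /chi => -[aE eE iE].
have alE := Crect (al ^+ 2).
set x := 'Re _ in aE iE alE; set y := 'Im _ in aE iE alE.
have xc : x^* = x by rewrite conj_Creal // Creal_Re.
have yc : y^* = y by rewrite conj_Creal // Creal_Im.
have i2 : 'i * 'i = -1 :> R[i] by rewrite -expr2 sqrCi.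
split.
  apply: (@intr_inj R[i]); rewrite !(rmorphD, rmorphM, rmorphXn) /= aE eE iE.
  have -> : (al * al^*) ^+ 2 = x ^+ 2 + y ^+ 2.
    rewrite exprMn -rmorphXn alE rmorphD rmorphM /= xc yc conjCi.
    by rewrite [LHS](_ : _ = x ^+ 2 - ('i * 'i) * y ^+ 2); [rewrite i2|]; ring.
  by ring.
rewrite (exprM al 2 2) alE !(rmorphB, rmorphM, rmorphXn) /= aE iE.
rewrite [LHS](_ : _ = x ^+ 2 + ('i * 'i) * y ^+ 2 + 2 * ('i * x * y)); last by ring.
by rewrite i2; field.
Qed.

Lemma chi_quartic_im (R : realType) (al : R[i]) (a e i : int) :
  (a%:~R, e%:~R, i%:~R) = chi al ->
  'Im (al ^+ 4) = (a ^+ 2 - i ^+ 2)%:~R / 2.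
Proof.
by case/chi_spec => _ ->; rewrite Im_rect ?realz // rpredM ?rpredV ?realz // realn.
Qed.

Lemma chi_quartic_real (R : realType) (al : R[i]) (a e i : int) :
  (a%:~R, e%:~R, i%:~R) = chi al ->
  (al ^+ 4 \is Num.real) = (a ^+ 2 == i ^+ 2).
Proof.
move=> E; have := chi_quartic_im E => imE.
rewrite -[RHS]subr_eq0 -(intr_eq0 R[i]).
apply/Creal_ImP/idP; rewrite imE.
  by move/eqP; rewrite mulf_eq0 invr_eq0 pnatr_eq0 orbF.
by move/eqP ->; rewrite mul0r.
Qed.

Lemma chi_sqrt_gauss (R : realType) (d r s : int) : 0 <= d ->
  let al : R[i] := sqrtC d%:~R * (r%:~R + 'i * s%:~R) in
  al ^+ 2 = (d * (r ^+ 2 - s ^+ 2))%:~R + 'i * (2 * (d * (r * s)))%:~R /\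
  al * al^* = (d * (r ^+ 2 + s ^+ 2))%:~R.
Proof.
move=> d0 al.
have i2 : 'i * 'i = -1 :> R[i] by rewrite -expr2 sqrCi.
have q2 : sqrtC d%:~R * sqrtC d%:~R = d%:~R :> R[i] by rewrite -expr2 sqrtCK.
have qc : (sqrtC d%:~R)^* = sqrtC d%:~R :> R[i].
  by rewrite conj_Creal // ger0_real // sqrtC_ge0 ler0z.
have -> : al^* = sqrtC d%:~R * (r%:~R - 'i * s%:~R).
  by rewrite /al rmorphM rmorphD rmorphM /= qc conjCi !rmorph_int mulNr.
rewrite /al.
rewrite !(rmorphB, rmorphD, rmorphM, rmorphXn) /=.
move: q2; set q := sqrtC _ => <-; set u := r%:~R; set v := s%:~R; split.
  rewrite [LHS](_ : _ = q * q * (u ^+ 2 + ('i * 'i) * v ^+ 2 + 2 * ('i * u * v))).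
    by rewrite i2; ring.
  by ring.
by rewrite [LHS](_ : _ = q * q * (u ^+ 2 - ('i * 'i) * v ^+ 2)); [rewrite i2|]; ring.
Qed.

(** The sign of a is free because the hourglass only sees a ^ 2. It is chosen so
    that ((a + i) / 2, (a - i) / 2) = (d (r ^ 2 - s ^ 2), 2 d r s), whose square
    root sqrt d (r + s 'i) needs a single quadratic irrationality; with the other
    sign sqrt 'i may come in. The middle component of chi is nonnegative, whence
    the absolute value of e. *)
Lemma chi_preimage (R : realType) (a e i : int) : a ^+ 2 + i ^+ 2 = 2 * e ^+ 2 ->
  exists (d a' : int) (al : R[i]),
    [/\ a' ^+ 2 = a ^+ 2, (a'%:~R, `|e|%:~R, i%:~R) = chi al,
        gaussZ (al ^+ 2), al * al^* = `|e|%:~R &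
        forall G : set R[i], G 'i -> G (sqrtC d%:~R) -> adjoinZ G al].
Proof.
move=> E; have [x [y [aE iE]]] := sum_and_double_difference E.
have /two_squares_param [d [r [s [d0 xE yE eE]]]] : x ^+ 2 + (2 * y) ^+ 2 = e ^+ 2.
  by move: E; rewrite -aE iE => E; lra.
have [] := @chi_sqrt_gauss R d r s d0.
set al := _ * _ => sqE nE; exists d, (x + 2 * y), al.
rewrite -xE -yE in sqE; rewrite -eE in nE.
split=> //.
- rewrite /chi nE sqE Re_rect ?realz // Im_rect ?realz // iE.
  by rewrite -rmorphD -rmorphB.
- rewrite sqE; apply: adjoinZ_add; first exact: adjoinZ_int.
  by apply: adjoinZ_mul; [exact: adjoinZ_gen | exact: adjoinZ_int].
move=> G Gi Gd; apply: adjoinZ_mul; first exact: adjoinZ_gen.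
apply: adjoinZ_add; first exact: adjoinZ_int.
by apply: adjoinZ_mul; [exact: adjoinZ_gen | exact: adjoinZ_int].
Qed.

Lemma chi_quartic_inj (R : realType) (al be : R[i]) (a b e h i : int) :
  (a%:~R, e%:~R, i%:~R) = chi al -> (b%:~R, e%:~R, h%:~R) = chi be ->
  al ^+ 4 = be ^+ 4 -> a ^+ 2 = b ^+ 2.
Proof.
move=> chia chib /(congr1 (fun z => 'Im z)).
rewrite (chi_quartic_im chia) (chi_quartic_im chib).
have n2 : (2 : R[i])^-1 != 0 by rewrite invr_eq0 pnatr_eq0.
move=> /(mulIf n2) /intr_inj.
by have [Ea _] := chi_spec chia; have [Eb _] := chi_spec chib; lra.
Qed.

(** Twice the imaginary part of the sum is
    (a ^ 2 - i ^ 2) + (b ^ 2 - h ^ 2) + (c ^ 2 - g ^ 2), that is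
    2 (a ^ 2 + b ^ 2 + c ^ 2) - 6 e ^ 2, and its real part
    a i + b h + c g is an integer in any case. *)
Lemma chi_quartic_sum (R : realType) (al be ga : R[i])
    (a b c e g h i : int) :
  (a%:~R, e%:~R, i%:~R) = chi al -> (b%:~R, e%:~R, h%:~R) = chi be ->
  (c%:~R, e%:~R, g%:~R) = chi ga ->
  (exists n : int, al ^+ 4 + be ^+ 4 + ga ^+ 4 = n%:~R) <->
  a ^+ 2 + b ^+ 2 + c ^+ 2 = 3 * e ^+ 2.
Proof.
move=> chia chib chic.
have [Ea qa] := chi_spec chia; have [Eb qb] := chi_spec chib.
have [Ec qc] := chi_spec chic.
have qE : al ^+ 4 + be ^+ 4 + ga ^+ 4 = (a * i + b * h + c * g)%:~R
    + 'i * (a ^+ 2 + b ^+ 2 + c ^+ 2 - 3 * e ^+ 2)%:~R.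
  have im (u v : int) : u ^+ 2 + v ^+ 2 = 2 * e ^+ 2 ->
      (u ^+ 2 - v ^+ 2)%:~R / 2 = (u ^+ 2 - e ^+ 2)%:~R :> R[i].
    move=> E; rewrite (_ : u ^+ 2 - v ^+ 2 = (u ^+ 2 - e ^+ 2) * 2); last by lra.
    by rewrite rmorphM /= mulfK // pnatr_eq0.
  rewrite qa qb qc !im // (_ : _ - 3 * e ^+ 2 =
    (a ^+ 2 - e ^+ 2) + (b ^+ 2 - e ^+ 2) + (c ^+ 2 - e ^+ 2)); last by ring.
  move: (a * i) (b * h) (c * g) (a ^+ 2 - _) (b ^+ 2 - _) (c ^+ 2 - _) => *.
  by rewrite !rmorphD /=; ring.
rewrite qE; split=> [[n nE]|E]; last first.
  by exists (a * i + b * h + c * g); rewrite E subrr mulr0 addr0.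
have : 'Im (n%:~R : R[i]) = 0 by apply/Creal_ImP; rewrite realz.
rewrite -nE Im_rect ?realz // => /eqP; rewrite intr_eq0 subr_eq0.
by move/eqP.
Qed.

Theorem theorem3p2 (R : realType) :
  (exists a b c e g h i : int, magic_hourglass a b c e g h i)
  <->
  (exists (A B C : int) (alpha beta gamma : R[i]) (a b c e g h i : int),
    [/\ ringK A B C alpha, ringK A B C beta & ringK A B C gamma] /\
    (exists n : int, alpha ^+ 4 + beta ^+ 4 + gamma ^+ 4 = n%:~R) /\
    [/\ gaussZ (alpha ^+ 2), gaussZ (beta ^+ 2) & gaussZ (gamma ^+ 2)] /\
    (alpha * alpha^* = beta * beta^* /\ beta * beta^* = gamma * gamma^*) /\
    [/\ (a%:~R, e%:~R, i%:~R) = chi alpha,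
        (b%:~R, e%:~R, h%:~R) = chi beta &
        (c%:~R, e%:~R, g%:~R) = chi gamma] /\
    uniq [:: alpha ^+ 4; beta ^+ 4; gamma ^+ 4] /\
    [/\ alpha ^+ 4 \isn't Num.real,
        beta ^+ 4 \isn't Num.real &
        gamma ^+ 4 \isn't Num.real]).
Proof.
split.
- move=> [a [b [c [e [g [h [i H]]]]]]].
  have [Ea Eb Ec Et] := diagonals_of_magic_hourglass H.
  case: H => dist _.
  have [A [a' [al [a2 chia Ga na Ka]]]] := chi_preimage R Ea.
  have [B [b' [be [b2 chib Gb nb Kb]]]] := chi_preimage R Eb.
  have [C [c' [ga [c2 chic Gc nc Kc]]]] := chi_preimage R Ec.
  exists A, B, C, al, be, ga, a', b', c', `|e|, g, h, i.
  have [nai nbh ncg] : [/\ a ^+ 2 != i ^+ 2, b ^+ 2 != h ^+ 2 & c ^+ 2 != g ^+ 2].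
    move: dist; rewrite /= !inE !negb_or => D.
    by split; apply/eqP => E; move: D; rewrite E eqxx ?andbF.
  have [nab nac nbc] : [/\ a ^+ 2 != b ^+ 2, a ^+ 2 != c ^+ 2 & b ^+ 2 != c ^+ 2].
    move: dist; rewrite /= !inE !negb_or => D.
    by split; apply/eqP => E; move: D; rewrite E eqxx ?andbF.
  have e2 : `|e| ^+ 2 = e ^+ 2 by rewrite -normrX ger0_norm ?sqr_ge0.
  split; first by split; [apply: Ka|apply: Kb|apply: Kc]; rewrite /= !inE eqxx ?orbT.
  split; first by apply/(chi_quartic_sum chia chib chic); rewrite e2 a2 b2 c2.
  split=> //; split; first by rewrite na nb nc.
  split=> //; split; last first.
    rewrite (chi_quartic_real chia) (chi_quartic_real chib).
    by rewrite (chi_quartic_real chic) a2 b2 c2.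
  rewrite /= !inE !negb_or !andbT -andbA; apply/and3P; split; apply/eqP => eq4.
  - by move: nab; rewrite -a2 -b2 (chi_quartic_inj chia chib eq4) eqxx.
  - by move: nac; rewrite -a2 -c2 (chi_quartic_inj chia chic eq4) eqxx.
  - by move: nbc; rewrite -b2 -c2 (chi_quartic_inj chib chic eq4) eqxx.
move=> [A [B [C [al [be [ga [a [b [c [e [g [h [i [_]]]]]]]]]]]]]].
move=> [sumZ [_ [_ [[chia chib chic] [_ [ra rb rc]]]]]].
exists a, b, c, e, g, h, i; apply: magic_hourglass_of_diagonals.
- by have [] := chi_spec chia.
- by have [] := chi_spec chib.
- by have [] := chi_spec chic.
- by apply/(chi_quartic_sum chia chib chic).
- by rewrite -(chi_quartic_real chia).
- by rewrite -(chi_quartic_real chib).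
by rewrite -(chi_quartic_real chic).
Qed.
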